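(* Every graph that is a counterexample to Conjecture A is also a counterexample to Conjecture B, where: Conjecture A: for any graph $G$ and any vertex $w$ in $G$, $\mu(G)\ge \mu((G-w)\cup K_1)$. Conjecture B: for any graph $G$ and any vertex $w$ in $G$ with $d_G(w)\ge 1$, if $H$ is a graph obtained from $G$ by deleting all but one of the edges which are incident to $w$, then $\mu(G)\ge\mu(H)$. That is, if $G$ is a graph for which there exists a vertex $w\in V(G)$ with $\mu(G)<\mu((G-w)\cup K_1)$, then there exist a vertex $w'\in V(G)$ with $d_G(w')\ge 1$ and a graph $H$ obtained from $G$ by deleting all but one of the edges incident to $w'$ such that $\mu(G)<\mu(H)$.
   Context: All graphs are finite and simple. For a graph $G$ and $x\in V(G)$, $d_G(x)$ denotes the degree of $x$ in $G$, and $G-x$ is the graph obtained by removing $x$ together with all edges incident with it. $(G-x)\cup K_1$ denotes the disjoint union of $G-x$ with a single isolated vertex. For a positive integer $\lambda$, a proper $\lambda$-coloring of $G$ is a map $c:V(G)\to\{1,\ldots,\lambda\}$ with $c(x)\ne c(y)$ whenever $xy\in E(G)$. For an $n$-vertex graph $G$, the mean color number $\mu(G)$ is the average, over all proper $n$-colorings $c$ of $G$, of the number of colors actually used by $c$ (that is, of $|c(V(G))|$). Equivalently, $$\mu(G)=\frac{\sum_{k=1}^{n}k\,\alpha(G,k)(n)_{k}}{\sum_{k=1}^{n}\alpha(G,k)(n)_{k}},$$ where $\alpha(G,k)$ is the number of partitions of $V(G)$ into exactly $k$ nonempty independent sets and $(n)_k=n(n-1)\cdots(n-k+1)$. *)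

(* Defs.v *)
From HB Require Import structures.
From mathcomp Require Import all_boot all_order all_algebra.

Set Implicit Arguments.
Unset Strict Implicit.
Unset Printing Implicit Defensive.

Import Order.TTheory GRing.Theory Num.Theory.

Record sgraph := SGraph {
  vertex :> finType;
  adj : rel vertex;
  adj_sym : symmetric adj;
  adj_irrefl : irreflexive adj }.

Arguments adj {s}.

Section Basics.
Variable G : sgraph.

Definition degree (x : G) : nat := #|[set y | adj x y]|.

Definition edges : {set {set G}} :=
  [set [set p.1; p.2] | p : G * G & adj p.1 p.2].

Definition incident_edges (x : G) : {set {set G}} :=
  [set e in edges | x \in e].

Definition proper_coloring (l : nat) (c : {ffun G -> 'I_l}) : bool :=
  [forall x, forall y, adj x y ==> (c x != c y)].

Definition colors_used (l : nat) (c : {ffun G -> 'I_l}) : nat :=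
  #|[set c x | x : G]|.

(* The average is over the proper colorings with as many colors as there are
   vertices; there is always at least one of them (any bijection). *)
Definition mean_color_number : rat :=
  ((\sum_(c : {ffun G -> 'I_#|G|} | proper_coloring c) (colors_used c)%:R) /
   (#|[set c : {ffun G -> 'I_#|G|} | proper_coloring c]|)%:R)%R.

End Basics.

Section VertexDeletion.
Variables (G : sgraph) (w : G).

Definition del_vertex_adj : rel {x : G | x != w} :=
  fun x y => adj (val x) (val y).

Lemma del_vertex_sym : symmetric del_vertex_adj.
Proof. by move=> x y; apply: adj_sym. Qed.

Lemma del_vertex_irrefl : irreflexive del_vertex_adj.
Proof. by move=> x; apply: adj_irrefl. Qed.

Definition del_vertex : sgraph := SGraph del_vertex_sym del_vertex_irrefl.

End VertexDeletion.

Section DisjointUnion.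
Variables G H : sgraph.

Definition disjoint_union_adj : rel (G + H)%type :=
  fun u v => match u, v with
             | inl x, inl y => adj x y
             | inr x, inr y => adj x y
             | _, _ => false
             end.

Lemma disjoint_union_sym : symmetric disjoint_union_adj.
Proof. by move=> [x|x] [y|y] //=; apply: adj_sym. Qed.

Lemma disjoint_union_irrefl : irreflexive disjoint_union_adj.
Proof. by move=> [x|x] /=; apply: adj_irrefl. Qed.

Definition disjoint_union : sgraph :=
  SGraph disjoint_union_sym disjoint_union_irrefl.

End DisjointUnion.

Section OneVertex.

Definition K1_adj : rel unit := fun _ _ => false.

Lemma K1_sym : symmetric K1_adj. Proof. by []. Qed.

Lemma K1_irrefl : irreflexive K1_adj. Proof. by []. Qed.

Definition K1 : sgraph := SGraph K1_sym K1_irrefl.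

End OneVertex.

Section EdgeDeletion.
Variables (G : sgraph) (F : {set {set G}}).

Definition del_edges_adj : rel G :=
  fun x y => adj x y && ([set x; y] \notin F).

Lemma del_edges_sym : symmetric del_edges_adj.
Proof. by move=> x y; rewrite /del_edges_adj adj_sym setUC. Qed.

Lemma del_edges_irrefl : irreflexive del_edges_adj.
Proof. by move=> x; rewrite /del_edges_adj adj_irrefl. Qed.

Definition del_edges : sgraph := SGraph del_edges_sym del_edges_irrefl.

End EdgeDeletion.

Definition keeps_one_edge_at (G : sgraph) (w : G) (H : sgraph) : Prop :=
  exists2 e, e \in incident_edges w & H = del_edges (incident_edges w :\ e).

Definition counterexampleA (G : sgraph) : Prop :=
  exists w : G,
    (mean_color_number G
       < mean_color_number (disjoint_union (del_vertex w) K1))%R.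

Definition counterexampleB (G : sgraph) : Prop :=
  exists w : G, 1 <= degree w /\
    exists H : sgraph, keeps_one_edge_at w H /\
      (mean_color_number G < mean_color_number H)%R.

(* Main.v *)
(* Deleting all edges at [w] but one, [wv], leaves [w] pendant at [v]; call this
   graph H and let H0 be H with [w] isolated, so that H0 is (G - w) + K1.  The
   proper colorings of H0 that are not proper for H are those with [c w = c v].
   Recoloring [w] by each of the n - 1 colors other than [c v] turns each of
   them into n - 1 proper colorings of H, every one obtained exactly once, and
   never loses a color, since [c v] is still used at [v].  Hence
   mu(H0) <= mu(H), and a counterexample to A at [w] is one to B at [w]. *)
Require Import Defs.
From HB Require Import structures.
From mathcomp Require Import all_boot all_order all_algebra.

Set Implicit Arguments.
Unset Strict Implicit.
Unset Printing Implicit Defensive.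

Import Order.TTheory GRing.Theory Num.Theory.

Lemma mean_color_number_iso (G H : sgraph) (f : G -> H) :
  bijective f -> (forall x y, adj (f x) (f y) = adj x y) ->
  mean_color_number G = mean_color_number H.
Proof.
move=> bij_f adj_f; have [g fK gK] := bij_f.
rewrite /mean_color_number (bij_eq_card bij_f).
set l := #|H|; pose h (c : {ffun H -> 'I_l}) : {ffun G -> 'I_l} := [ffun x => c (f x)].
have bij_h : bijective h.
  exists (fun d : {ffun G -> 'I_l} => [ffun y => d (g y)]) => c; apply/ffunP=> x.
    by rewrite !ffunE gK.
  by rewrite !ffunE fK.
have proper_h c : proper_coloring (h c) = proper_coloring c.
  apply/forallP/forallP=> pc x; apply/forallP=> y.
    by have /forallP/(_ (g y)) := pc (g x); rewrite -adj_f !ffunE !gK.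
  by have /forallP/(_ (f y)) := pc (f x); rewrite adj_f !ffunE.
have used_h c : colors_used (h c) = colors_used c.
  apply: eq_card => a; apply/imsetP/imsetP=> -[x _ ->].
    by exists (f x); rewrite ?ffunE.
  by exists (g x); rewrite // ffunE gK.
rewrite -!sum1dep_card (reindex h) /=; last exact: onW_bij.
rewrite [in X in (_ / X)%R](reindex h) /=; last exact: onW_bij.
congr (_ / _%:R)%R; last exact: eq_bigl.
by apply: eq_big => c *; rewrite ?used_h ?proper_h.
Qed.

Lemma mem_incident_edges (G : sgraph) (w x y : G) :
  adj x y -> ([set x; y] \in incident_edges w) = (w == x) || (w == y).
Proof.
move=> xy; rewrite inE in_set2; suff -> : [set x; y] \in edges G by [].
by apply/imsetP; exists (x, y); rewrite ?inE.
Qed.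

(** Sending the added vertex to [w] is an isomorphism. It moves the graph back onto the vertex type
    of [G], so that its colorings are the same functions as those of [G]. *)
Lemma mean_color_number_isolate (G : sgraph) (w : G) :
  mean_color_number (disjoint_union (del_vertex w) K1)
  = mean_color_number (del_edges (incident_edges w)).
Proof.
pose f (u : disjoint_union (del_vertex w) K1) : del_edges (incident_edges w) :=
  match u with inl x => val x | inr _ => w end.
pose g (x : G) : {x : G | x != w} + unit :=
  if insub x is Some u then inl u else inr tt.
apply: (@mean_color_number_iso _ _ f).
  exists g => [[x|[]]|x]; rewrite /g /f /=.
  - by rewrite valK.
  - by rewrite insubF ?eqxx.
  - by case: insubP => [u _ //|]; rewrite negbK => /eqP.
have isolated x : del_edges_adj (incident_edges w) w x = false.
  rewrite /del_edges_adj; case wx: (adj w x) => //.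
  by rewrite mem_incident_edges ?eqxx.
move=> [x|[]] [y|[]] /=; rewrite ?isolated ?[_ _ w]del_edges_sym ?isolated //.
rewrite /del_edges_adj /del_vertex_adj.
case xy: (adj _ _) => //=; rewrite mem_incident_edges //.
by rewrite !(eq_sym w) (negPf (valP x)) (negPf (valP y)).
Qed.

Section PendantVersusIsolated.

Variables (G : sgraph) (w v : G).
Hypothesis wv : adj w v.

Let H0 := del_edges (incident_edges w).
Let H := del_edges (incident_edges w :\ [set w; v]).

Let vw : (v == w) = false.
Proof. by apply/eqP=> E; move: wv; rewrite E adj_irrefl. Qed.

(** In this form properness visibly ignores the color of [w], so recoloring [w] preserves it. *)
Lemma proper_isolatedP l (c : {ffun G -> 'I_l}) :
  reflect (forall x y, x != w -> y != w -> adj x y -> c x != c y)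
          (@proper_coloring H0 l c).
Proof.
apply: (iffP forallP) => [pc x y xw yw xy|pc x].
  have /forallP/(_ y)/implyP := pc x; apply.
  by rewrite /adj /= /del_edges_adj xy mem_incident_edges // !(eq_sym w) negb_or xw.
apply/forallP=> y; apply/implyP; rewrite /adj /= /del_edges_adj => /andP[xy].
rewrite mem_incident_edges // !(eq_sym w) negb_or => /andP[xw yw].
exact: pc.
Qed.

Lemma proper_pendant l (c : {ffun G -> 'I_l}) :
  @proper_coloring H l c = @proper_coloring H0 l c && (c w != c v).
Proof.
apply/forallP/andP=> [pc|[/proper_isolatedP pc cwv] x].
  split; last first.
    have /forallP/(_ v)/implyP := pc w; apply.
    by rewrite /adj /= /del_edges_adj wv !inE eqxx.
  apply/proper_isolatedP => x y xw yw xy.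
  have /forallP/(_ y)/implyP := pc x; apply.
  rewrite /adj /= /del_edges_adj xy in_setD1 mem_incident_edges //.
  by rewrite !(eq_sym w) (negPf xw) (negPf yw) andbF.
apply/forallP=> y; apply/implyP; rewrite /adj /= /del_edges_adj => /andP[xy].
rewrite in_setD1 mem_incident_edges // negb_and negbK.
(* Either [xy] is the kept edge, so that [x] and [y] are [w] and [v] in some order, or it avoids
   [w]. *)
case/orP=> [/eqP/setP E|]; last first.
  by rewrite !(eq_sym w) negb_or => /andP[xw yw]; apply: pc.
have := E w; have := E v; rewrite !inE !eqxx orbT /=.
case/orP=> /eqP <-; case/orP=> /eqP Ew //; rewrite -?Ew //.
- by have := vw; rewrite Ew eqxx.
- by rewrite eq_sym.
- by have := vw; rewrite Ew eqxx.
Qed.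

Let recolor l (c : {ffun G -> 'I_l}) (a : 'I_l) : {ffun G -> 'I_l} :=
  [ffun x => if x == w then a else c x].

Lemma sum_proper_pendant l (F : {ffun G -> 'I_l} -> nat) :
  \sum_(c | @proper_coloring H l c) F c
  = \sum_(c | @proper_coloring H0 l c && (c w == c v))
      \sum_(a | a != c v) F (recolor c a).
Proof.
have proper_recolor c a :
    @proper_coloring H0 l (recolor c a) = @proper_coloring H0 l c.
  apply/proper_isolatedP/proper_isolatedP=> pc x y xw yw xy;
  by have := pc x y xw yw xy; rewrite !ffunE (negPf xw) (negPf yw).
rewrite pair_big_dep /=.
(* The inverse gives [w] the color of [v] and remembers the former color of [w]. *)
rewrite (reindex_onto (fun p => recolor p.1 p.2)
                      (fun c => (recolor c (c v), c w))) /=.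
  apply: eq_bigl => -[c a] /=.
  rewrite proper_pendant proper_recolor !ffunE eqxx vw xpair_eqE eqxx andbT.
  rewrite -!andbA; congr (_ && _); rewrite andbC; congr (_ && _).
  (* The round trip fixes [(c, a)] exactly when [c w = c v]. *)
  apply/eqP/eqP=> [/ffunP/(_ w)|cwv]; first by rewrite !ffunE eqxx.
  by apply/ffunP=> x; rewrite !ffunE; case: eqP => // ->.
by move=> c _; apply/ffunP=> x; rewrite !ffunE; case: eqP => // ->.
Qed.

Lemma colors_used_recolor l (c : {ffun G -> 'I_l}) a :
  c w = c v -> colors_used c <= colors_used (recolor c a).
Proof.
move=> cwv; apply/subset_leq_card/subsetP=> _ /imsetP[x _ ->].
have [->|xw] := eqVneq x w; apply/imsetP.
  by exists v; rewrite // ffunE vw.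
by exists x; rewrite // ffunE (negPf xw).
Qed.

Lemma mean_color_number_isolated_le_pendant :
  (mean_color_number H0 <= mean_color_number H)%R.
Proof.
rewrite /mean_color_number -!natr_sum -!sum1dep_card /=.
set l := #|G|.
have split_sum (F : {ffun G -> 'I_l} -> nat) :
    \sum_(c | @proper_coloring H0 l c) F c
    = \sum_(c | @proper_coloring H0 l c && (c w == c v)) F c
      + \sum_(c | @proper_coloring H l c) F c.
  rewrite (bigID (fun c : {ffun G -> 'I_l} => c w == c v)) /=; congr (_ + _).
  by apply: eq_bigl => c; rewrite proper_pendant.
have card_other (i : 'I_l) : \sum_(a | a != i) 1 = l.-1.
  by rewrite sum1_card cardC1 card_ord.
rewrite !split_sum.
(* The goal becomes [(S2 + S1) / (N2 + N1) <= S1 / N1], where index 2 marks the colorings of [H0]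
   with [c w = c v]. *)
set S1 := \sum_(c | @proper_coloring H l c) _.
set S2 := \sum_(c | _ && _) @colors_used _ _ _.
set N1 := \sum_(c | @proper_coloring H l c) _.
set N2 := \sum_(c | _ && _) _.
have S12 : N2 * l.-1 = N1.
  rewrite /N1 sum_proper_pendant /N2 big_distrl /=.
  by apply: eq_bigr => c _; rewrite mul1n card_other.
have S12' : S2 * l.-1 <= S1.
  rewrite /S1 sum_proper_pendant /S2 big_distrl /=.
  apply: leq_sum => c /andP[_ /eqP cwv].
  rewrite -(card_other (c v)) big_distrr /=.
  by apply: leq_sum => a _; rewrite muln1; apply: colors_used_recolor.
(* No proper coloring need be exhibited: if [N1 = 0], then [l >= 2] forces [N2 = 0], and both
   quotients are 0 by the convention for division by 0. *)
have [N10|N1_gt0] := posnP N1.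
  have l_gt1 : 0 < l.-1.
    rewrite -subn1 subn_gt0; apply/card_gt1P; exists w, v; split=> //.
    by rewrite eq_sym vw.
  have N20 : N2 = 0.
    by move/eqP: S12; rewrite N10 muln_eq0 => /orP[/eqP //|]; rewrite eqn0Ngt l_gt1.
  by rewrite N10 N20 !mulr0n !invr0 !mulr0.
(* Cross-multiplying and cancelling [S1 * N1] leaves [S2 * N1 <= S1 * N2], which is [S12']
   multiplied by [N2]. *)
rewrite ler_pdivrMr ?ltr0n ?addn_gt0 ?N1_gt0 ?orbT // mulrAC.
rewrite ler_pdivlMr ?ltr0n // -!natrM ler_nat mulnDl mulnDr leq_add2r.
by rewrite -S12 mulnCA [S1 * N2]mulnC leq_mul2l S12' orbT.
Qed.

End PendantVersusIsolated.

Theorem theorem2p6 (G : sgraph) :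
  counterexampleA G -> counterexampleB G.
Proof.
case=> w; rewrite mean_color_number_isolate => muG.
have [dw0|dw_gt0] := posnP (degree w).
  (* If [w] is already isolated, isolating it changes nothing, against the strict inequality
     [muG]. *)
  suff E : mean_color_number G = mean_color_number (del_edges (incident_edges w)).
    by rewrite -E ltxx in muG.
  have nadj y : adj w y = false.
    by apply/negbTE; move/eqP: dw0; rewrite cards_eq0 => /eqP/setP/(_ y); rewrite !inE => ->.
  apply: (@mean_color_number_iso G (del_edges (incident_edges w)) id); first by exists id.
  move=> x y; rewrite {1}/adj /= /del_edges_adj; case xy: (adj x y) => //=.
  rewrite mem_incident_edges //; apply/norP; split; apply/eqP=> E.
    by rewrite -E nadj in xy.
  by rewrite -E adj_sym nadj in xy.
exists w; split=> //.
have /card_gt0P[v] := dw_gt0; rewrite inE => wv.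
exists (del_edges (incident_edges w :\ [set w; v])); split.
  by exists [set w; v] => //; rewrite mem_incident_edges // eqxx.
exact: lt_le_trans muG (mean_color_number_isolated_le_pendant wv).
Qed.
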